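(* Let $\mathbf{F}$ be an arbitrary field and let $(T,[\cdot,\cdot,\cdot],\alpha)$ be a multiplicative Hom-Lie triple system over $\mathbf{F}$ with $H^5_{\alpha,\alpha}(T,T)=0$. Then every 3-Hom-cocycle $d_1\in Z^3_{\alpha,\alpha}(T,T)$ is integrable, i.e. there is a 1-parameter formal deformation $d_t$ of $(T,[\cdot,\cdot,\cdot],\alpha)$ of the form $d_t=d_0+d_1t+d_2t^2+\cdots$ whose coefficient of $t$ is the given $d_1$.
   Context: **Multiplicative Hom-Lie triple system (Hom-LTS).** A triple $(T,[\cdot,\cdot,\cdot],\alpha)$ with $T$ an $\mathbf{F}$-vector space, a trilinear map $T\times T\times T\to T$, $(x,y,z)\mapsto[xyz]$, and a linear map $\alpha:T\to T$ such that for all $x,y,z,u,v\in T$: (1) $[xxz]=0$; (2) $[xyz]+[yzx]+[zxy]=0$; (3) $[\alpha(u)\alpha(v)[xyz]]=[[uvx]\alpha(y)\alpha(z)]+[\alpha(x)[uvy]\alpha(z)]+[\alpha(x)\alpha(y)[uvz]]$; (4) $\alpha([xyz])=[\alpha(x)\alpha(y)\alpha(z)]$. **Formal deformations.** $T[[t]]$ denotes the $\mathbf{F}[[t]]$-module of formal power series with coefficients in $T$. An $\mathbf{F}$-(multi)linear map on $T$ is extended to $T[[t]]$ $\mathbf{F}[[t]]$-(multi)linearly, e.g. $f(\sum_i x_it^i,\sum_j y_jt^j,\sum_k z_kt^k)=\sum_{i,j,k\ge0}f(x_i,y_j,z_k)t^{i+j+k}$. A 1-parameter formal deformation of $(T,[\cdot,\cdot,\cdot],\alpha)$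 is a formal power series $d_t=\sum_{i\ge0}d_it^i:T[[t]]^3\to T[[t]]$, where each $d_i:T^3\to T$ is $\mathbf{F}$-trilinear (extended to $T[[t]]$) and $d_0(x,y,z)=[xyz]$, such that - $d_t(\alpha(x),\alpha(y),\alpha(z))=\alpha(d_t(x,y,z))$; - $d_t(x,x,y)=0$; - $d_t(x,y,z)+d_t(y,z,x)+d_t(z,x,y)=0$; - $d_t(\alpha(u),\alpha(v),d_t(x,y,z))=d_t(d_t(u,v,x),\alpha(y),\alpha(z))+d_t(\alpha(x),d_t(u,v,y),\alpha(z))+d_t(\alpha(x),\alpha(y),d_t(u,v,z))$. **Cohomology with adjoint coefficients (odd degrees).** Put $\theta(x,y)(z)=[zxy]$ and $D(x,y)(z)=\theta(y,x)(z)-\theta(x,y)(z)=[xyz]$ (the adjoint representation of $T$ on itself with respect to $\alpha$). For $m\ge1$, $C^m_{\alpha,\alpha}(T,T)$ is the space of $m$-linear maps $f:T^m\to T$ such that - $\alpha(f(x_1,\dots,x_m))=f(\alpha(x_1),\dots,\alpha(x_m))$; - (for $m\ge3$) $f(x_1,\dots,x_{m-3},x,x,x_m)=0$; - (for $m\ge3$) $f(x_1,\dots,x_{m-3},x,y,z)+f(x_1,\dots,x_{m-3},y,z,x)+f(x_1,\dots,x_{m-3},z,x,y)=0$. For $n\ge1$, $\delta^{2n-1}_{hom}:C^{2n-1}_{\alpha,\alpha}(T,T)\to C^{2n+1}_{\alpha,\alpha}(T,T)$ is $$\begin{aligned}\delta^{2n-1}_{hom}f(x_1,\dots,x_{2n+1})=\;&\theta(\alpha^{n-1}(x_{2n}),\alpha^{n-1}(x_{2n+1}))f(x_1,\dots,x_{2n-1})\\&-\theta(\alpha^{n-1}(x_{2n-1}),\alpha^{n-1}(x_{2n+1}))f(x_1,\dots,x_{2n-2},x_{2n})\\&+\sum_{k=1}^n(-1)^{n+k}D(\alpha^{n-1}(x_{2k-1}),\alpha^{n-1}(x_{2k}))f(x_1,\dots,\widehat{x_{2k-1}},\widehat{x_{2k}},\dots,x_{2n+1})\\&+\sum_{k=1}^n\sum_{j=2k+1}^{2n+1}(-1)^{n+k+1}f(\alpha(x_1),\dots,\widehat{x_{2k-1}},\widehat{x_{2k}},\dots,[x_{2k-1}x_{2k}x_j],\dots,\alpha(x_{2n+1})),\end{aligned}$$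 where a hat means omission and, in the last sum, $[x_{2k-1}x_{2k}x_j]$ stands in the place of $x_j$ and every other remaining argument $x_i$ is replaced by $\alpha(x_i)$. These satisfy $\delta^{2n+1}_{hom}\delta^{2n-1}_{hom}=0$. For odd $m\geq 3$: $Z^m_{\alpha,\alpha}(T,T)=\ker\delta^m_{hom}$ (its elements are the $m$-Hom-cocycles), $B^m_{\alpha,\alpha}(T,T)=\delta^{m-2}_{hom}C^{m-2}_{\alpha,\alpha}(T,T)$, $H^m_{\alpha,\alpha}(T,T)=Z^m_{\alpha,\alpha}(T,T)/B^m_{\alpha,\alpha}(T,T)$. *)

(* Defs.v *)
From HB Require Import structures.
From mathcomp Require Import all_boot all_algebra.
From mathcomp Require Import boolp classical_sets functions.

Set Implicit Arguments.
Unset Strict Implicit.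
Unset Printing Implicit Defensive.

Import GRing.Theory.
Local Open Scope classical_set_scope.
Local Open Scope ring_scope.

Section Multilinear.
Context {F : fieldType} {T : lmodType F}.

Definition trilinear (f : T -> T -> T -> T) : Prop :=
  [/\ forall y z, linear (fun x => f x y z),
      forall x z, linear (fun y => f x y z)
    & forall x y, linear (fun z => f x y z)].

Definition multilinear (m : nat) (f : m.-tuple T -> T) : Prop :=
  forall (i : 'I_m) (v : m.-tuple T),
    linear (fun a => f [tuple if j == i then a else tnth v j | j < m]).

End Multilinear.

Record multiplicative_homLTS (F : fieldType) (T : lmodType F)
    (br : T -> T -> T -> T) (alpha : {linear T -> T}) : Prop := {
  homLTS_trilinear : trilinear br;
  homLTS_alt : forall x z, br x x z = 0;
  homLTS_cyclic : forall x y z, br x y z + br y z x + br z x y = 0;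
  homLTS_fundamental : forall u v x y z,
    br (alpha u) (alpha v) (br x y z) =
      br (br u v x) (alpha y) (alpha z) + br (alpha x) (br u v y) (alpha z)
      + br (alpha x) (alpha y) (br u v z);
  homLTS_multiplicative : forall x y z,
    alpha (br x y z) = br (alpha x) (alpha y) (alpha z)
}.

Section FormalDeformation.
Context {F : fieldType} {T : lmodType F}.

(* A formal power series in T[[t]] is its sequence of coefficients. *)
Definition series_map (g : T -> T) (x : nat -> T) : nat -> T :=
  fun n => g (x n).

Definition series_map3 (f : T -> T -> T -> T) (x y z : nat -> T) : nat -> T :=
  fun n => \sum_(i < n.+1) \sum_(j < n.+1) \sum_(k < n.+1 | (i + j + k == n)%N)
    f (x i) (y j) (z k).

(* The coefficient of t^n in (\sum_l d_l t^l)(x, y, z). *)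
Definition deform (d : nat -> T -> T -> T -> T) (x y z : nat -> T) : nat -> T :=
  fun n => \sum_(l < n.+1) series_map3 (d l) x y z (n - l)%N.

Record formal_deformation (br : T -> T -> T -> T) (alpha : {linear T -> T})
    (d : nat -> T -> T -> T -> T) : Prop := {
  deformation_trilinear : forall i, trilinear (d i);
  deformation_0 : forall x y z, d 0%N x y z = br x y z;
  deformation_multiplicative : forall x y z : nat -> T,
    deform d (series_map alpha x) (series_map alpha y) (series_map alpha z)
    = series_map alpha (deform d x y z);
  deformation_alt : forall x y : nat -> T, deform d x x y = 0;
  deformation_cyclic : forall x y z : nat -> T,
    deform d x y z + deform d y z x + deform d z x y = 0;
  deformation_fundamental : forall u v x y z : nat -> T,
    deform d (series_map alpha u) (series_map alpha v) (deform d x y z) =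
      deform d (deform d u v x) (series_map alpha y) (series_map alpha z)
      + deform d (series_map alpha x) (deform d u v y) (series_map alpha z)
      + deform d (series_map alpha x) (series_map alpha y) (deform d u v z)
}.

End FormalDeformation.

Unset Implicit Arguments.

Section Cohomology.
Context {F : fieldType} {T : lmodType F}.
Variables (br : T -> T -> T -> T) (alpha : {linear T -> T}).

Definition theta (x y : T) : T -> T := fun z => br z x y.

Definition thetaD (x y : T) : T -> T := fun z => theta y x z - theta x y z.

(* The sequence s viewed as an m-tuple; only used with size s = m. *)
Definition args (m : nat) (s : seq T) : m.-tuple T := [tuple s`_i | i < m].

Definition cochain (m : nat) : set (m.-tuple T -> T) :=
  [set f | [/\ multilinear f,
    forall x : m.-tuple T, alpha (f x) = f [tuple of map alpha x],
    (3 <= m)%N -> forall (p : (m - 3).-tuple T) (x y : T),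
      f (args m (p ++ [:: x; x; y])) = 0
  & (3 <= m)%N -> forall (p : (m - 3).-tuple T) (x y z : T),
      f (args m (p ++ [:: x; y; z])) + f (args m (p ++ [:: y; z; x]))
      + f (args m (p ++ [:: z; x; y])) = 0]].

(* The i-th index (counting from 1) left after omitting 2k-1 and 2k. *)
Definition skip_pair (k i : nat) : nat := if (i < k.*2.-1)%N then i else i.+2.

(* The coboundary of degree 2n-1, for n >= 1; X i is the i-th argument,
   counting from 1. *)
Definition delta (n : nat) (f : (n.*2.-1).-tuple T -> T) :
    (n.*2.+1).-tuple T -> T := fun x =>
  let X i := x`_i.-1 in
  let A i := iter n.-1 alpha (X i) in
  theta (A n.*2) (A n.*2.+1) (f [tuple X i.+1 | i < n.*2.-1])
  - theta (A n.*2.-1) (A n.*2.+1)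
      (f [tuple X (if i.+1 == n.*2.-1 then n.*2 else i.+1) | i < n.*2.-1])
  + \sum_(1 <= k < n.+1) (-1) ^+ (n + k) *:
      thetaD (A k.*2.-1) (A k.*2)
        (f [tuple X (skip_pair k i.+1) | i < n.*2.-1])
  + \sum_(1 <= k < n.+1) \sum_(k.*2.+1 <= j < n.*2.+2) (-1) ^+ (n + k + 1) *:
      f [tuple if skip_pair k i.+1 == j then br (X k.*2.-1) (X k.*2) (X j)
               else alpha (X (skip_pair k i.+1)) | i < n.*2.-1].

(* Cocycles, coboundaries and cohomology in degree 2n+1, for n >= 1. *)
Definition cocycle (n : nat) : set ((n.*2.+1).-tuple T -> T) :=
  [set f | cochain n.*2.+1 f /\ delta n.+1 f = 0].

Definition coboundary (n : nat) : set ((n.*2.+1).-tuple T -> T) :=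
  [set delta n g | g in cochain n.*2.-1].

(* The quotient space of cocycles by coboundaries, as the set of cosets. *)
Definition cohomology (n : nat) : set (set ((n.*2.+1).-tuple T -> T)) :=
  [set [set f + b | b in coboundary n] | f in cocycle n].

(* The quotient space is zero: its only element is the zero coset. *)
Definition cohomology_trivial (n : nat) : Prop :=
  cohomology n = [set coboundary n].

End Cohomology.

(* Main.v *)
(* The obstruction to extending a deformation d_0 + ... + d_(n-1) t^(n-1) to
   order n is the coefficient of t^n in the defect of the fundamental identity
   of d_t. For any trilinear operation compatible with alpha, not only for a
   Hom-Lie triple system, this defect is annihilated by the degree 5 coboundary
   formed with the operation itself (a Bianchi identity). Applied to d_t over
   T[[t]], whose defect vanishes below order n, the coefficient of t^n of that
   identity says that the obstruction is a 5-cocycle for d_0. As H^5 = 0 it is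
   the coboundary of some 3-cochain, which is taken as d_n. No division occurs,
   so the characteristic is irrelevant. *)
Require Import Defs.
From mathcomp Require Import all_boot all_algebra.
From mathcomp Require Import boolp classical_sets functions.
From mathcomp Require Import zify.

Set Implicit Arguments.
Unset Strict Implicit.
Unset Printing Implicit Defensive.

Import GRing.Theory.
Local Open Scope ring_scope.

(** * Linear identities in abelian groups *)

Inductive zexp := ZZero | ZVar of nat | ZAdd of zexp & zexp | ZOpp of zexp.

Fixpoint zeval (V : zmodType) (env : seq V) (e : zexp) : V :=
  match e with
  | ZZero => 0
  | ZVar i => env`_i
  | ZAdd e1 e2 => zeval env e1 + zeval env e2
  | ZOpp e1 => - zeval env e1
  end.

Fixpoint zcoef (e : zexp) (i : nat) : int :=
  match e with
  | ZZero => 0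
  | ZVar j => (j == i)%:Z
  | ZAdd e1 e2 => zcoef e1 i + zcoef e2 i
  | ZOpp e1 => - zcoef e1 i
  end.

Lemma zevalE (V : zmodType) (env : seq V) (e : zexp) :
  zeval env e = \sum_(i < size env) env`_i *~ zcoef e i.
Proof.
elim: e => [|j|e1 IH1 e2 IH2|e IH] /=.
- by rewrite big1.
- have [lt_j|le_j] := ltnP j (size env); last first.
    rewrite nth_default // big1 // => i _.
    by rewrite (gtn_eqF (leq_trans (ltn_ord i) le_j)).
  rewrite (bigD1 (Ordinal lt_j)) //= eqxx mulr1z big1 ?addr0 // => i.
  by rewrite -val_eqE /= eq_sym => /negPf->.
- by rewrite IH1 IH2 -big_split; apply: eq_bigr => i _; rewrite mulrzDr.
- by rewrite IH -sumrN; apply: eq_bigr => i _; rewrite mulrNz.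
Qed.

(** By [zevalE] both sides are integer combinations of the atoms. The coefficients are closed terms,
    so the premise is settled by computation. *)
Lemma zeval_eq (V : zmodType) (env : seq V) (e1 e2 : zexp) :
  all (fun i => zcoef e1 i == zcoef e2 i) (iota 0 (size env)) ->
  zeval env e1 = zeval env e2.
Proof.
move=> /allP eq12; rewrite !zevalE; apply: eq_bigr => i _.
by rewrite (eqP (eq12 i _)) // mem_iota ltn_ord.
Qed.

Ltac zindex a env :=
  lazymatch env with
  | a :: _ => constr:(0%N)
  | _ :: ?env' => let i := zindex a env' in constr:(S i)
  end.
Ltac zmember a env :=
  lazymatch env with
  | nil => constr:(false)
  | a :: _ => constr:(true)
  | _ :: ?env' => zmember a env'
  end.
Ltac zatoms env e :=
  lazymatch e with
  | 0%R => env
  | (?e1 + ?e2)%R => let env1 := zatoms env e1 in zatoms env1 e2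
  | (- ?e1)%R => zatoms env e1
  | ?a => lazymatch zmember a env with
          | true => env
          | false => constr:(a :: env)
          end
  end.
Ltac zreify env e :=
  lazymatch e with
  | 0%R => constr:(ZZero)
  | (?e1 + ?e2)%R =>
      let r1 := zreify env e1 in let r2 := zreify env e2 in constr:(ZAdd r1 r2)
  | (- ?e1)%R => let r1 := zreify env e1 in constr:(ZOpp r1)
  | ?a => let i := zindex a env in constr:(ZVar i)
  end.
(* Proves equalities that hold in every abelian group, by comparing the
   coefficients of syntactically equal atoms on both sides. *)
Ltac abelian_group :=
  lazymatch goal with
  | |- @eq ?V ?e1 ?e2 =>
      let env1 := zatoms (@nil V) e1 in
      let env := zatoms env1 e2 in
      let r1 := zreify env e1 in
      let r2 := zreify env e2 in
      exact: (@zeval_eq _ env r1 r2 (erefl true))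
  end.

(* The terms of the fundamental identity, with [f] outside and [g] inside. *)
Definition fund (V : zmodType) (alpha : V -> V) (f g : V -> V -> V -> V)
    (u v x y z : V) : V :=
  f (alpha u) (alpha v) (g x y z) - f (g u v x) (alpha y) (alpha z)
  - f (alpha x) (g u v y) (alpha z) - f (alpha x) (alpha y) (g u v z).

(* The left-hand side is the degree 5 coboundary of [F] formed with [m] in place
   of the bracket; each [theta] is written as [m] after moving its argument to
   the first or, with a sign change, to the second position. *)
Lemma fund_bianchi (V : zmodType) (alpha : V -> V) (m : V -> V -> V -> V)
    (F := fund alpha m m) :
  (forall x y, {morph (fun a => m a x y) : a b / a + b}) ->
  (forall x y, {morph (fun a => m x a y) : a b / a + b}) ->
  (forall x y, {morph (fun a => m x y a) : a b / a + b}) ->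
  (forall x y z, alpha (m x y z) = m (alpha x) (alpha y) (alpha z)) ->
  forall a b c d x y z (h := fun a => alpha (alpha a)),
  m (h a) (h b) (F c d x y z) - m (h c) (h d) (F a b x y z)
  + m (h x) (h y) (F a b c d z)
  + m (F a b c d x) (h y) (h z) + m (h x) (F a b c d y) (h z)
  - (F (m a b c) (alpha d) (alpha x) (alpha y) (alpha z)
     + F (alpha c) (m a b d) (alpha x) (alpha y) (alpha z)
     + F (alpha c) (alpha d) (m a b x) (alpha y) (alpha z)
     + F (alpha c) (alpha d) (alpha x) (m a b y) (alpha z)
     + F (alpha c) (alpha d) (alpha x) (alpha y) (m a b z))
  + (F (alpha a) (alpha b) (m c d x) (alpha y) (alpha z)
     + F (alpha a) (alpha b) (alpha x) (m c d y) (alpha z)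
     + F (alpha a) (alpha b) (alpha x) (alpha y) (m c d z))
  - F (alpha a) (alpha b) (alpha c) (alpha d) (m x y z) = 0.
Proof.
move=> mD1 mD2 mD3 malpha a b c d x y z h.
have opp (g : V -> V) : {morph g : u v / u + v} -> {morph g : u / - u}.
  move=> gD u; apply: (addrI (g u)); rewrite -gD !subrr.
  by apply: (addrI (g 0)); rewrite -gD !addr0.
have mN1 u v w : m (- u) v w = - m u v w by exact: (opp (fun u => m u v w)).
have mN2 u v w : m u (- v) w = - m u v w by exact: (opp (fun v => m u v w)).
have mN3 u v w : m u v (- w) = - m u v w by exact: (opp (m u v)).
(* [malpha] carries each [alpha] down to the variables, so that the expanded threefold products
   become literally comparable and cancel. *)
rewrite /F /fund /h !(mD1, mD2, mD3, mN1, mN2, mN3, malpha).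
abelian_group.
Qed.

(** * Power series and t-linear maps *)

Section Series.
Context {F : fieldType} {T : lmodType F}.
Local Notation series := (nat -> T).
Implicit Types (x y z : series) (g h : series -> series).

Definition cser (a : T) : series := fun n => a *+ (n == 0)%N.
(** Multiplication by [t]. *)
Definition shift x : series := fun n => if n is n'.+1 then x n' else 0.

Lemma cser_shift x : x = cser (x 0%N) + shift (fun n => x n.+1).
Proof.
apply/funext => -[|n]; rewrite addrfctE /cser /=.
  by rewrite mulr1n addr0.
by rewrite mulr0n add0r.
Qed.

(* Additivity and commutation with multiplication by [t]. *)
Definition tlinear g : Prop :=
  {morph g : x y / x + y} /\ {morph g : x / shift x}.

Lemma shiftD x y : shift (x + y) = shift x + shift y.
Proof. by apply/funext => -[|n] //=; rewrite addrfctE /= ?addr0. Qed.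

Lemma shiftN x : shift (- x) = - shift x.
Proof. by apply/funext => -[|n] //=; rewrite opprfctE /= ?oppr0. Qed.

Lemma tlinear0 g : tlinear g -> g 0 = 0.
Proof. by move=> [gD _]; apply: (addrI (g 0)); rewrite -gD !addr0. Qed.

Lemma tlinear_add g h : tlinear g -> tlinear h -> tlinear (fun x => g x + h x).
Proof.
move=> [gD gS] [hD hS]; split=> [x y|x]; first by rewrite gD hD addrACA.
by rewrite gS hS shiftD.
Qed.

Lemma tlinear_opp g : tlinear g -> tlinear (fun x => - g x).
Proof.
move=> [gD gS]; split=> [x y|x]; first by rewrite gD opprD.
by rewrite gS shiftN.
Qed.

Lemma tlinear_comp g h : tlinear g -> tlinear h -> tlinear (fun x => g (h x)).
Proof. by move=> [gD gS] [hD hS]; split=> [x y|x]; rewrite ?hD ?hS. Qed.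

Lemma tlinear_series_map (alpha : {linear T -> T}) : tlinear (series_map alpha).
Proof.
split=> [x y|x]; apply/funext.
  by move=> n; rewrite /series_map addrfctE /= linearD.
by case=> [|n]; rewrite /series_map /= ?linear0.
Qed.

(* Writing [x] as [x_0 + t x'] reduces every claim to constant series. *)
Lemma tlinear_valuation g n :
    tlinear g -> (forall a k, (k < n)%N -> g (cser a) k = 0) ->
  forall x, (forall k, (k < n)%N -> g x k = 0) /\ g x n = g (cser (x 0%N)) n.
Proof.
move=> [gD gS] gcst.
have gE x k : g x k = g (cser (x 0%N)) k + shift (g (fun n => x n.+1)) k.
  by rewrite {1}(cser_shift x) gD gS addrfctE.
have g0 x k : (k < n)%N -> g x k = 0.
  elim: k x => [|k IH] x lt_k; rewrite gE gcst //= ?addr0 //.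
  by rewrite add0r IH // ltnW.
move=> x; split=> [k|]; first exact: g0.
(* In degree [n] the shifted part contributes its coefficient of degree [n - 1], which vanishes by
   [g0]. *)
rewrite gE; case: n g0 {gcst} => [|n] g0 /=; first by rewrite addr0.
by rewrite [X in _ + X]g0 ?addr0.
Qed.

Lemma tlinear_eq0 g :
  tlinear g -> (forall a, g (cser a) = 0) -> forall x, g x = 0.
Proof.
move=> gl gcst x; apply/funext => n.
have [|_ ->] := @tlinear_valuation g n gl _ x; first by move=> a k _; rewrite gcst.
by rewrite gcst.
Qed.

Lemma series_map_cser (alpha : {linear T -> T}) a :
  series_map alpha (cser a) = cser (alpha a).
Proof. by apply/funext => n; rewrite /series_map /cser linearMn. Qed.

Definition tlinear3 (m : series -> series -> series -> series) : Prop :=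
  [/\ forall y z, tlinear (fun x => m x y z),
      forall x z, tlinear (fun y => m x y z)
    & forall x y, tlinear (fun z => m x y z)].

Definition tlinear5
    (m : series -> series -> series -> series -> series -> series) : Prop :=
  [/\ forall v x y z, tlinear (fun u => m u v x y z),
      forall u x y z, tlinear (fun v => m u v x y z),
      forall u v y z, tlinear (fun x => m u v x y z),
      forall u v x z, tlinear (fun y => m u v x y z)
    & forall u v x y, tlinear (fun z => m u v x y z)].

Lemma tlinear3_eq0 m : tlinear3 m ->
  (forall a b c, m (cser a) (cser b) (cser c) = 0) -> forall x y z, m x y z = 0.
Proof.
move=> [m1 m2 m3] mcst x y z.
apply: (tlinear_eq0 (m1 y z)) => a; apply: (tlinear_eq0 (m2 _ z)) => b.
by apply: (tlinear_eq0 (m3 _ _)) => c.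
Qed.

Lemma tlinear5_valuation m n : tlinear5 m ->
    (forall a b c d e k, (k < n)%N ->
       m (cser a) (cser b) (cser c) (cser d) (cser e) k = 0) ->
  forall u v x y z, (forall k, (k < n)%N -> m u v x y z k = 0) /\
    m u v x y z n = m (cser (u 0%N)) (cser (v 0%N)) (cser (x 0%N))
                      (cser (y 0%N)) (cser (z 0%N)) n.
Proof.
move=> [m1 m2 m3 m4 m5] mcst u v x y z.
(* The slots are freed one at a time, starting from the last; the vanishing half of each statement
   is the hypothesis on constants for the next slot. *)
have val5 a b c d z' := tlinear_valuation (m5 (cser a) (cser b) (cser c) (cser d))
  (fun e => @mcst a b c d e) z'.
have val4 a b c z' y' := tlinear_valuation (m4 (cser a) (cser b) (cser c) z')
  (fun d => (val5 a b c d z').1) y'.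
have val3 a b y' z' x' := tlinear_valuation (m3 (cser a) (cser b) y' z')
  (fun c => (val4 a b c z' y').1) x'.
have val2 a x' y' z' v' := tlinear_valuation (m2 (cser a) x' y' z')
  (fun b => (val3 a b y' z' x').1) v'.
have [val1 ->] := tlinear_valuation (m1 v x y z)
  (fun a => (val2 a x y z v).1) u.
split=> //; rewrite (val2 _ _ _ _ _).2 (val3 _ _ _ _ _).2.
by rewrite (val4 _ _ _ _ _).2 (val5 _ _ _ _ _).2.
Qed.

End Series.

(** * Trilinear maps extended to power series *)

Section Trilinear.
Context {F : fieldType} {T : lmodType F}.
Implicit Types f g : T -> T -> T -> T.

Lemma trilinear_rot f : trilinear f -> trilinear (fun x y z => f z x y).
Proof. by move=> [f1 f2 f3]; split=> *; [apply: f2|apply: f3|apply: f1]. Qed.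

Section Rules.
Variables (f : T -> T -> T -> T) (fl : trilinear f).

Lemma trilinearD1 y z : {morph (fun x => f x y z) : a b / a + b}.
Proof. by move=> a b; have [/(_ y z 1 a b)] := fl; rewrite !scale1r. Qed.
Lemma trilinearD2 x z : {morph (fun y => f x y z) : a b / a + b}.
Proof. by move=> a b; have [_ /(_ x z 1 a b)] := fl; rewrite !scale1r. Qed.
Lemma trilinearD3 x y : {morph (fun z => f x y z) : a b / a + b}.
Proof. by move=> a b; have [_ _ /(_ x y 1 a b)] := fl; rewrite !scale1r. Qed.

Lemma trilinear0l y z : f 0 y z = 0.
Proof. by apply: (addrI (f 0 y z)); rewrite -trilinearD1 !addr0. Qed.
Lemma trilinear0m x z : f x 0 z = 0.
Proof. by apply: (addrI (f x 0 z)); rewrite -trilinearD2 !addr0. Qed.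
Lemma trilinear0r x y : f x y 0 = 0.
Proof. by apply: (addrI (f x y 0)); rewrite -trilinearD3 !addr0. Qed.
End Rules.

(** Rotating the arguments reduces claims about the second and third slots to the first. *)
Lemma series_map3_rot f x y z :
  series_map3 f x y z = series_map3 (fun b c a => f a b c) y z x.
Proof.
apply/funext => n; rewrite /series_map3 exchange_big; apply: eq_bigr => j _ /=.
under eq_bigr do rewrite big_mkcond.
rewrite exchange_big; apply: eq_bigr => k _ /=; rewrite [RHS]big_mkcond.
by apply: eq_bigr => i _; rewrite -addnA addnC.
Qed.

Lemma deform_rot (d : nat -> T -> T -> T -> T) x y z :
  deform d x y z = deform (fun l b c a => d l a b c) y z x.
Proof.
apply/funext => n; rewrite /deform; apply: eq_bigr => l _.
by rewrite series_map3_rot.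
Qed.

Lemma series_map3_tlinear f y z :
  trilinear f -> tlinear (fun x => series_map3 f x y z).
Proof.
move=> fl; split=> [a b|x]; apply/funext => n; rewrite /series_map3.
  rewrite [in RHS]addrfctE /= -big_split; apply: eq_bigr => i _ /=.
  rewrite -big_split; apply: eq_bigr => j _ /=.
  rewrite -big_split; apply: eq_bigr => k _ /=.
  by rewrite addrfctE /= (trilinearD1 fl).
rewrite big_ord_recl /= big1 ?add0r => [|j _]; last first.
  by rewrite big1 // => k _; rewrite (trilinear0l fl).
case: n => [|n] /=; first by rewrite big_ord0.
(* After the shift of [i], the ranges of [j] and [k] are one longer than in degree [n]; the extra
   last indices contribute nothing, since they already make the total degree too large. *)
apply: eq_bigr => i _; rewrite big_ord_recr /= [X in _ + X]big1 ?addr0.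
  apply: eq_bigr => j _; rewrite big_mkcond big_ord_recr /=.
  rewrite ifF; first by rewrite addr0 -big_mkcond.
  by apply/negP; rewrite /bump /= => /eqP; lia.
by move=> k /eqP; rewrite /bump /=; lia.
Qed.
End Trilinear.

(** * Deformed operations on power series *)

Section Deform.
Context {F : fieldType} {T : lmodType F}.
Implicit Types (g : (nat -> T) -> nat -> T) (f : T -> T -> T -> T).
Implicit Types (d : nat -> T -> T -> T -> T).

Lemma deform_tlinear1 d y z :
  (forall l, trilinear (d l)) -> tlinear (fun x => deform d x y z).
Proof.
move=> dl; split=> [a b|x]; apply/funext => n; rewrite /deform.
  rewrite [in RHS]addrfctE /= -big_split; apply: eq_bigr => l _ /=.
  by rewrite (series_map3_tlinear y z (dl l)).1 addrfctE.
under eq_bigr do rewrite (series_map3_tlinear y z (dl _)).2.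
rewrite big_ord_recr /= subnn addr0; case: n => [|n] /=; first by rewrite big_ord0.
by apply: eq_bigr => l _; rewrite subSn // -ltnS.
Qed.

Lemma deform_tlinear d : (forall l, trilinear (d l)) -> tlinear3 (deform d).
Proof.
move=> dl.
have dl' l : trilinear (fun b c a => d l a b c) by exact: (trilinear_rot (dl l)).
split=> [y z|x z|x y]; first exact: deform_tlinear1.
  have -> : (fun y => deform d x y z) =
      fun y => deform (fun l b c a => d l a b c) y z x.
    by apply/funext => y; rewrite deform_rot.
  exact: deform_tlinear1.
have -> : (fun z => deform d x y z) =
    fun z => deform (fun l c a b => d l a b c) z x y.
  by apply/funext => z; rewrite deform_rot deform_rot.
by apply: deform_tlinear1 => l; exact: (trilinear_rot (dl' l)).
Qed.

Lemma deform_cser d a b c : (forall l, trilinear (d l)) ->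
  deform d (cser a) (cser b) (cser c) = fun n => d n a b c.
Proof.
move=> dl; apply/funext => n; rewrite /deform.
have cstS e i :  cser e (bump 0%N i) = 0 :> T by rewrite /cser /bump leq0n add1n.
have cst0 f k : trilinear f ->
    series_map3 f (cser a) (cser b) (cser c) k = f a b c *+ (k == 0)%N.
  move=> fl; rewrite /series_map3 2!big_ord_recl /= big_mkcond big_ord_recl /=.
  rewrite !big1 ?addr0 //=.
  - by rewrite eq_sym; case: eqP.
  - move=> i _; rewrite big1 // => j _; rewrite big1 // => l _.
    by rewrite cstS (trilinear0l fl).
  - by move=> i _; rewrite big1 // => l _; rewrite cstS (trilinear0m fl).
  - by move=> l _; rewrite cstS (trilinear0r fl); case: ifP.
rewrite big_ord_recr /= cst0 // subnn mulr1n big1 ?add0r // => l _.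
by rewrite cst0 // subn_eq0 leqNgt ltn_ord.
Qed.

(** A t-linear map is automatically t-adically continuous: peeling off constant terms expresses
    degree [n] through finitely many values on constants. *)
Lemma tlinear_sum g n x : tlinear g ->
  g x n = \sum_(l < n.+1) g (cser (x (n - l)%N)) l.
Proof.
move=> [gD gS]; elim: n x => [|n IH] x.
  by rewrite big_ord1 {1}(cser_shift x) gD gS addrfctE /= addr0.
rewrite {1}(cser_shift x) gD gS addrfctE /= IH [RHS]big_ord_recr /= subnn [LHS]addrC.
by congr (_ + _); apply: eq_bigr => l _; rewrite subSn // -ltnS.
Qed.

(** In [tlinear_sum] only the summand [l = 0] uses the coefficient of [x] in degree [n]; all others
    meet a vanishing one. *)
Lemma tlinear_head g n x : tlinear g -> (forall k, (k < n)%N -> x k = 0) ->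
  g x n = g (cser (x n)) 0%N.
Proof.
move=> gl x0; rewrite tlinear_sum // big_ord_recl /= subn0 big1 ?addr0 // => l _.
rewrite x0; last by rewrite /bump /=; have := ltn_ord l; lia.
have -> : cser (0 : T) = 0 by apply/funext => k; rewrite /cser mul0rn.
by rewrite tlinear0.
Qed.

Section Identities.
Variables (alpha : {linear T -> T}) (d : nat -> T -> T -> T -> T).
Hypothesis dl : forall l, trilinear (d l).
Let dtl := deform_tlinear dl.

Lemma tlinear_deform1 g y z :
  tlinear g -> tlinear (fun x => deform d (g x) y z).
Proof. by have [m1 _ _] := dtl; exact: (tlinear_comp (m1 y z)). Qed.
Lemma tlinear_deform2 g x z :
  tlinear g -> tlinear (fun y => deform d x (g y) z).
Proof. by have [_ m2 _] := dtl; exact: (tlinear_comp (m2 x z)). Qed.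
Lemma tlinear_deform3 g x y :
  tlinear g -> tlinear (fun z => deform d x y (g z)).
Proof. by have [_ _ m3] := dtl; exact: (tlinear_comp (m3 x y)). Qed.

Lemma deform_multiplicative :
    (forall l a b c, alpha (d l a b c) = d l (alpha a) (alpha b) (alpha c)) ->
  forall x y z,
  deform d (series_map alpha x) (series_map alpha y) (series_map alpha z)
  = series_map alpha (deform d x y z).
Proof.
move=> dalpha x y z; apply/eqP; rewrite -subr_eq0; apply/eqP.
have al := tlinear_series_map alpha.
have [m1 m2 m3] := dtl.
apply: (tlinear3_eq0 (m := fun x y z => _ - _) _ _ x y z).
  split=> [y' z'|x' z'|x' y']; apply: tlinear_add.
  - exact: tlinear_deform1.
  - exact: tlinear_opp (tlinear_comp al (m1 y' z')).
  - exact: tlinear_deform2.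
  - exact: tlinear_opp (tlinear_comp al (m2 x' z')).
  - exact: tlinear_deform3.
  - exact: tlinear_opp (tlinear_comp al (m3 x' y')).
move=> a b c; rewrite !series_map_cser !deform_cser //.
by apply/eqP; rewrite subr_eq0; apply/eqP/funext => n; rewrite /series_map dalpha.
Qed.

Lemma deform_cyclic :
    (forall l a b c, d l a b c + d l b c a + d l c a b = 0) ->
  forall x y z, deform d x y z + deform d y z x + deform d z x y = 0.
Proof.
move=> dcyc; have [m1 m2 m3] := dtl; apply: tlinear3_eq0.
  by split=> *; apply: tlinear_add; do ?apply: tlinear_add.
by move=> a b c; rewrite !deform_cser //; apply/funext => n; rewrite !addrfctE dcyc.
Qed.

(** The expression is quadratic in [x], so the reduction to constants is not direct. Writing [x] as
    [x_0 + t x'], the square of [x_0] vanishes by [dcst] and the cross terms cancel by [dswap]. What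
    remains is [t^2] times the same expression in [x'], which allows induction on the degree in
    every characteristic. *)
Lemma deform_alt :
  (forall l a b, d l a a b = 0) -> forall x z, deform d x x z = 0.
Proof.
move=> dalt; have [m1 m2 m3] := dtl.
have dswap x y z : deform d x y z + deform d y x z = 0.
  apply: (tlinear3_eq0 (m := fun x y z => _ + _) _ _ x y z).
    by split=> *; apply: tlinear_add.
  move=> a b c; rewrite !deform_cser //; apply/funext => n.
  have := dalt n (a + b) c; rewrite addrfctE (trilinearD1 (dl n)).
  rewrite !(trilinearD2 (dl n)).
  by rewrite !dalt add0r addr0.
have dcst a z : deform d (cser a) (cser a) z = 0.
  apply: (tlinear_eq0 (m3 _ _)) => c; rewrite deform_cser //.
  by apply/funext => n; rewrite dalt.
have dxx x z : deform d x x z =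
    shift (shift (deform d (fun n => x n.+1) (fun n => x n.+1) z)).
  rewrite {1 2}(cser_shift x) (m1 _ _).1 !(m2 _ _).1 dcst add0r addrA.
  by rewrite dswap add0r (m1 _ _).2 (m2 _ _).2.
move=> x z; apply/funext => n; elim/ltn_ind: n x => n IH x.
by rewrite dxx; case: n IH => [|[|n]] IH //=; exact: IH.
Qed.

End Identities.
End Deform.

(** * The obstruction *)

Section Obstruction.
Context {F : fieldType} {T : lmodType F}.
Variable alpha : {linear T -> T}.

(* The coefficient of [t ^ n] in the fundamental identity for [d]. *)
Definition obstruction (d : nat -> T -> T -> T -> T) n (u v x y z : T) : T :=
  \sum_(l < n.+1) fund alpha (d l) (d (n - l)%N) u v x y z.

Variable d : nat -> T -> T -> T -> T.
Hypothesis dl : forall l, trilinear (d l).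
Let dtl := deform_tlinear dl.
Let al := tlinear_series_map alpha.
Local Notation fundt := (fund (series_map alpha) (deform d) (deform d)).

Lemma fund_deform_tlinear : tlinear5 fundt.
Proof.
have [m1 m2 m3] := dtl; rewrite /fund.
by split=> *;
  (apply: tlinear_add; [apply: tlinear_add; [apply: tlinear_add|]|]);
  do ?apply: tlinear_opp;
  first [exact: tlinear_deform1 | exact: tlinear_deform2 | exact: tlinear_deform3].
Qed.

Lemma fund_deform_cser u v x y z n :
  fundt (cser u) (cser v) (cser x) (cser y) (cser z) n
  = obstruction d n u v x y z.
Proof.
have [m1 m2 m3] := dtl.
rewrite /fund !series_map_cser !addrfctE !opprfctE !deform_cser //.
(* In the four terms of [fund] the inner series sits in slot 3, 1, 2 and 3. *)
rewrite (tlinear_sum _ _ (m3 _ _)) (tlinear_sum _ _ (m1 _ _)).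
rewrite (tlinear_sum _ _ (m2 _ _)) (tlinear_sum _ _ (m3 _ _)).
rewrite -!sumrN -!big_split /=; apply: eq_bigr => l _.
by rewrite !deform_cser.
Qed.

(** The defect of [deform d] is t-linear in each of its five slots, and on constants its
    coefficients are the obstructions. *)
Lemma fund_deform_valuation n :
    (forall k u v x y z, (k < n)%N -> obstruction d k u v x y z = 0) ->
  forall u v x y z, (forall k, (k < n)%N -> fundt u v x y z k = 0) /\
    fundt u v x y z n = obstruction d n (u 0%N) (v 0%N) (x 0%N) (y 0%N) (z 0%N).
Proof.
move=> obs0 u v x y z; rewrite -fund_deform_cser.
apply: (tlinear5_valuation fund_deform_tlinear) => a b c e f k lt_k.
by rewrite fund_deform_cser obs0.
Qed.

Hypothesis dalpha : forall l x y z,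
  alpha (d l x y z) = d l (alpha x) (alpha y) (alpha z).

(** This is the coefficient of [t ^ n] in [fund_bianchi] for [deform d], evaluated at constant
    series. *)
Lemma obstruction_bianchi n (R := obstruction d n) (m := d 0%N)
    (h := fun a => alpha (alpha a)) :
    (forall k u v x y z, (k < n)%N -> obstruction d k u v x y z = 0) ->
  forall a b c e x y z : T,
  m (h a) (h b) (R c e x y z) - m (h c) (h e) (R a b x y z)
  + m (h x) (h y) (R a b c e z)
  + m (R a b c e x) (h y) (h z) + m (h x) (R a b c e y) (h z)
  - (R (m a b c) (alpha e) (alpha x) (alpha y) (alpha z)
     + R (alpha c) (m a b e) (alpha x) (alpha y) (alpha z)
     + R (alpha c) (alpha e) (m a b x) (alpha y) (alpha z)
     + R (alpha c) (alpha e) (alpha x) (m a b y) (alpha z)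
     + R (alpha c) (alpha e) (alpha x) (alpha y) (m a b z))
  + (R (alpha a) (alpha b) (m c e x) (alpha y) (alpha z)
     + R (alpha a) (alpha b) (alpha x) (m c e y) (alpha z)
     + R (alpha a) (alpha b) (alpha x) (alpha y) (m c e z))
  - R (alpha a) (alpha b) (alpha c) (alpha e) (m x y z) = 0.
Proof.
move=> obs0 a b c e x y z.
have [m1 m2 m3] := dtl.
have fundE := fund_deform_valuation obs0.
have := @fund_bianchi _ (series_map alpha) (deform d)
  (fun _ _ => (m1 _ _).1) (fun _ _ => (m2 _ _).1) (fun _ _ => (m3 _ _).1)
  (fun _ _ _ => esym (deform_multiplicative dl dalpha _ _ _))
  (cser a) (cser b) (cser c) (cser e) (cser x) (cser y) (cser z).
move=> /(congr1 (fun s => s n)); rewrite !addrfctE !opprfctE ?addrfctE.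
rewrite !(fundE _ _ _ _ _).2.
(* Five terms have the defect inside [deform d], three times in slot 3, then in slots 1 and 2. Being
   divisible by [t ^ n], it meets only [d 0] in degree [n]. *)
rewrite (tlinear_head (m3 _ _) (fundE _ _ _ _ _).1).
rewrite (tlinear_head (m3 _ _) (fundE _ _ _ _ _).1).
rewrite (tlinear_head (m3 _ _) (fundE _ _ _ _ _).1).
rewrite (tlinear_head (m1 _ _) (fundE _ _ _ _ _).1).
rewrite (tlinear_head (m2 _ _) (fundE _ _ _ _ _).1).
by rewrite !(fundE _ _ _ _ _).2 !series_map_cser !deform_cser.
Qed.

Lemma obstruction0_deformation (br : T -> T -> T -> T) :
    d 0%N = br ->
    (forall l x z, d l x x z = 0) ->
    (forall l x y z, d l x y z + d l y z x + d l z x y = 0) ->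
    (forall n u v x y z, obstruction d n u v x y z = 0) ->
  formal_deformation br alpha d.
Proof.
move=> d0 dalt dcyc obs0; split=> //; first by rewrite d0.
- exact: deform_multiplicative.
- exact: deform_alt.
- exact: deform_cyclic.
move=> u v x y z; apply/eqP; rewrite -subr_eq0 !opprD !addrA; apply/eqP/funext => n.
have [//|_ fundE] := @fund_deform_valuation n _ u v x y z.
by rewrite -/(fundt u v x y z) fundE obs0.
Qed.
End Obstruction.

(** * Cochains *)

Section LinearClosure.
Context {F : fieldType} {T : lmodType F}.
Implicit Types g h : T -> T.

Lemma linear_predD g h : linear g -> linear h -> linear (fun x => g x + h x).
Proof. by move=> gl hl a x y; rewrite gl hl scalerDr addrACA. Qed.

Lemma linear_predN g : linear g -> linear (fun x => - g x).
Proof. by move=> gl a x y; rewrite gl opprD scalerN. Qed.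

Lemma linear_pred_sum n (G : 'I_n -> T -> T) :
  (forall l, linear (G l)) -> linear (fun x => \sum_(l < n) G l x).
Proof.
move=> Gl a x y; rewrite scaler_sumr -big_split; apply: eq_bigr => l _.
by rewrite Gl.
Qed.
End LinearClosure.

Section Cochains.
Context {F : fieldType} {T : lmodType F}.
Variable alpha : {linear T -> T}.

Definition on3 (f : T -> T -> T -> T) : 3.-tuple T -> T :=
  fun x => f x`_0 x`_1 x`_2.

Definition on5 (f : T -> T -> T -> T -> T -> T) : 5.-tuple T -> T :=
  fun x => f x`_0 x`_1 x`_2 x`_3 x`_4.

Lemma on3K (f : 3.-tuple T -> T) : on3 (fun x y z => f [tuple x; y; z]) = f.
Proof.
apply/funext => x; congr f; apply: val_inj => /=.
case/tupleP: x => a x; case/tupleP: x => b x; case/tupleP: x => c x.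
by rewrite tuple0.
Qed.

(** The curried form of [cochain alpha 3]. The bracket satisfies it too, so all coefficients of a
    deformation are treated alike. *)
Record cochain3 (f : T -> T -> T -> T) : Prop := {
  cochain3_trilinear : trilinear f;
  cochain3_alt : forall x z, f x x z = 0;
  cochain3_cyclic : forall x y z, f x y z + f y z x + f z x y = 0;
  cochain3_alpha : forall x y z, alpha (f x y z) = f (alpha x) (alpha y) (alpha z)
}.

Lemma nth_mktuple_lt n (E : 'I_n -> T) k (lt_kn : (k < n)%N) :
  [tuple E i | i < n]`_k = E (Ordinal lt_kn).
Proof. by rewrite -(tnth_nth _ _ (Ordinal lt_kn)) tnth_mktuple. Qed.

Lemma tuple3_eq (E : 'I_3 -> T) :
  [tuple E i | i < 3] =
    [tuple E (@Ordinal 3 0 isT); E (@Ordinal 3 1 isT); E (@Ordinal 3 2 isT)].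
Proof.
apply: eq_from_tnth => -[[|[|[|//]]] i]; rewrite tnth_mktuple;
  rewrite (tnth_nth 0) /=; congr E; exact: val_inj.
Qed.

Lemma cochain3P (f : 3.-tuple T -> T) :
  cochain alpha 3 f -> cochain3 (fun x y z => f [tuple x; y; z]).
Proof.
move=> [fl falpha falt fcyc].
have args3 (x y z : T) : args 3 [:: x; y; z] = [tuple x; y; z].
  by rewrite /args tuple3_eq.
split.
- split=> [y z|x z|x y] c a b.
  (* The entry [0] is a placeholder, overwritten in the slot that varies. *)
  + have := fl (@Ordinal 3 0 isT) [tuple 0; y; z] c a b.
    by rewrite !tuple3_eq !(tnth_nth 0).
  + have := fl (@Ordinal 3 1 isT) [tuple x; 0; z] c a b.
    by rewrite !tuple3_eq !(tnth_nth 0).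
  + have := fl (@Ordinal 3 2 isT) [tuple x; y; 0] c a b.
    by rewrite !tuple3_eq !(tnth_nth 0).
- by move=> x z; have := falt isT [tuple] x z; rewrite /= args3.
- by move=> x y z; have := fcyc isT [tuple] x y z; rewrite /= !args3.
- by move=> x y z; rewrite falpha; congr f; apply: val_inj.
Qed.

Lemma cochain_on5 (f : T -> T -> T -> T -> T -> T) :
    (forall v x y z, linear (fun u => f u v x y z)) ->
    (forall u x y z, linear (fun v => f u v x y z)) ->
    (forall u v y z, linear (fun x => f u v x y z)) ->
    (forall u v x z, linear (fun y => f u v x y z)) ->
    (forall u v x y, linear (fun z => f u v x y z)) ->
    (forall u v x z, f u v x x z = 0) ->
    (forall u v x y z, f u v x y z + f u v y z x + f u v z x y = 0) ->
    (forall u v x y z, alpha (f u v x y z)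
       = f (alpha u) (alpha v) (alpha x) (alpha y) (alpha z)) ->
  cochain alpha 5 (on5 f).
Proof.
move=> f1 f2 f3 f4 f5 falt fcyc falpha.
have on5_args (s : seq T) : on5 f (args 5 s) = f s`_0 s`_1 s`_2 s`_3 s`_4.
  by rewrite /on5 /args !nth_mktuple_lt.
split.
- move=> i v; rewrite /on5 => c a b.
  rewrite !nth_mktuple_lt; case: i => -[|[|[|[|[|//]]]]] lt_i; rewrite -!val_eqE /=.
  + exact: f1.
  + exact: f2.
  + exact: f3.
  + exact: f4.
  + exact: f5.
- move=> x; rewrite /on5 falpha.
  by rewrite !(nth_map 0) ?size_tuple.
- move=> _ p x y; case/tupleP: p => u p; case/tupleP: p => v p.
  by rewrite tuple0 on5_args /=.
- move=> _ p x y z; case/tupleP: p => u p; case/tupleP: p => v p.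
  by rewrite tuple0 !on5_args /=.
Qed.

Section Fund.
Variables f g : T -> T -> T -> T.
Hypotheses (fc : cochain3 f) (gc : cochain3 g).

Lemma cochain3_swap x y z : f x y z = - f y x z.
Proof.
have fl := cochain3_trilinear fc; apply/eqP; rewrite -addr_eq0.
have := cochain3_alt fc (x + y) z; rewrite (trilinearD1 fl) !(trilinearD2 fl).
by rewrite !(cochain3_alt fc) add0r addr0 => ->.
Qed.

Lemma fund_alt u v x z : fund alpha f g u v x x z = 0.
Proof.
rewrite /fund (cochain3_alt gc) (cochain3_alt fc) subr0.
rewrite (trilinear0r (cochain3_trilinear fc)) sub0r cochain3_swap opprK.
by rewrite subrr.
Qed.

Lemma fund_cyclic u v x y z :
  fund alpha f g u v x y z + fund alpha f g u v y z x + fund alpha f g u v z x y = 0.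
Proof.
have fl := cochain3_trilinear fc.
rewrite /fund.
have gz : g z x y = - g x y z - g y z x.
  apply: (addrI (g x y z + g y z x)); rewrite (cochain3_cyclic gc).
  by abelian_group.
have fN a b c : f a b (- c) = - f a b c.
  by apply: (addrI (f a b c)); rewrite -(trilinearD3 fl) !subrr (trilinear0r fl).
rewrite gz (trilinearD3 fl) !fN.
(* The nine terms left are grouped by their inner factor [g u v x], [g u v y] or [g u v z]; each
   group is a cyclic sum of [f]. *)
transitivity
 (- ((f (g u v x) (alpha y) (alpha z) + f (alpha y) (alpha z) (g u v x)
      + f (alpha z) (g u v x) (alpha y))
  + (f (g u v y) (alpha z) (alpha x) + f (alpha z) (alpha x) (g u v y)
      + f (alpha x) (g u v y) (alpha z))
  + (f (g u v z) (alpha x) (alpha y) + f (alpha x) (alpha y) (g u v z)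
      + f (alpha y) (g u v z) (alpha x)))); first by abelian_group.
by rewrite !(cochain3_cyclic fc) !addr0 oppr0.
Qed.

Lemma fund_alpha u v x y z : alpha (fund alpha f g u v x y z)
  = fund alpha f g (alpha u) (alpha v) (alpha x) (alpha y) (alpha z).
Proof. by rewrite /fund !linearB /= !(cochain3_alpha fc) !(cochain3_alpha gc). Qed.

End Fund.
End Cochains.

(** * Coboundaries in low degree *)

Section Delta.
Context {F : fieldType} {T : lmodType F}.
Variables (br : T -> T -> T -> T) (alpha : {linear T -> T}).
Hypothesis br_cochain : cochain3 alpha br.

Lemma thetaDE x y z : thetaD br x y z = br x y z.
Proof.
rewrite /thetaD /theta (cochain3_swap br_cochain z y).
apply: (addIr (br y z x + br z x y)); rewrite [RHS]addrA.
rewrite (cochain3_cyclic br_cochain).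
by abelian_group.
Qed.

Lemma sum_index_iota m n (G : nat -> T) :
  \sum_(m <= k < n) G k = foldr (fun k s => G k + s) 0 (iota m (n - m)).
Proof. by rewrite unlock. Qed.

(** Up to sign, the coboundary in degree 3 is the linearised fundamental identity: the coefficient
    of [t] in [fund] for [br + t f]. *)
Lemma delta2E (f : T -> T -> T -> T) (x : 5.-tuple T) :
  delta br alpha 2 (on3 f) x =
    - (fund alpha br f x`_0 x`_1 x`_2 x`_3 x`_4
       + fund alpha f br x`_0 x`_1 x`_2 x`_3 x`_4).
Proof.
rewrite /delta !sum_index_iota.
rewrite -[iota 1 _]/[:: 1; 2]%N.
rewrite /foldr !sum_index_iota.
rewrite -[iota 1.*2.+1 _]/[:: 3; 4; 5]%N -[iota 2.*2.+1 _]/[:: 5]%N.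
rewrite /foldr /on3 !nth_mktuple_lt.
rewrite /skip_pair /double /addn /= !thetaDE.
rewrite !exprS expr0 !mulN1r ?opprK !scaleN1r !scale1r.
move: (x`_0) (x`_1) (x`_2) (x`_3) (x`_4) => a b c e g.
(* The second [theta] term has the value of [f] in slot 1, while [fund] has it in slot 2. *)
rewrite /theta /fund (cochain3_swap br_cochain (f a b e)).
by abelian_group.
Qed.

(** The right-hand side is arranged to match [obstruction_bianchi] with [br] for [m] and [f] for
    [R]. *)
Lemma delta3E (f : T -> T -> T -> T -> T -> T) (x : 7.-tuple T)
    (h := fun a => alpha (alpha a)) :
  delta br alpha 3 (on5 f) x =
    let: (a, b, c, e) := (x`_0, x`_1, x`_2, x`_3) in
    let: (x, y, z) := (x`_4, x`_5, x`_6) in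
    br (h a) (h b) (f c e x y z) - br (h c) (h e) (f a b x y z)
    + br (h x) (h y) (f a b c e z)
    + br (f a b c e x) (h y) (h z) + br (h x) (f a b c e y) (h z)
    - (f (br a b c) (alpha e) (alpha x) (alpha y) (alpha z)
       + f (alpha c) (br a b e) (alpha x) (alpha y) (alpha z)
       + f (alpha c) (alpha e) (br a b x) (alpha y) (alpha z)
       + f (alpha c) (alpha e) (alpha x) (br a b y) (alpha z)
       + f (alpha c) (alpha e) (alpha x) (alpha y) (br a b z))
    + (f (alpha a) (alpha b) (br c e x) (alpha y) (alpha z)
       + f (alpha a) (alpha b) (alpha x) (br c e y) (alpha z)
       + f (alpha a) (alpha b) (alpha x) (alpha y) (br c e z))
    - f (alpha a) (alpha b) (alpha c) (alpha e) (br x y z).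
Proof.
rewrite /delta !sum_index_iota.
rewrite -[iota 1 _]/[:: 1; 2; 3]%N.
rewrite /foldr !sum_index_iota.
rewrite -[iota 1.*2.+1 _]/[:: 3; 4; 5; 6; 7]%N.
rewrite -[iota 2.*2.+1 _]/[:: 5; 6; 7]%N -[iota 3.*2.+1 _]/[:: 7]%N.
rewrite /foldr /on5 !nth_mktuple_lt.
rewrite /skip_pair /double /addn /= !thetaDE.
rewrite !exprS expr0 !mulN1r ?opprK !scaleN1r !scale1r.
move: (x`_0) (x`_1) (x`_2) (x`_3) (x`_4) (x`_5) (x`_6) => a b c e x1 y z.
rewrite /theta /h (cochain3_swap br_cochain (f a b c e y)).
by abelian_group.
Qed.

Lemma cohomology_trivial_coboundary (f : 5.-tuple T -> T) :
  cohomology_trivial br alpha 2 -> cocycle br alpha 2 f ->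
  exists2 g : T -> T -> T -> T, cochain3 alpha g & delta br alpha 2 (on3 g) = f.
Proof.
move=> H5 f_cocycle.
(* Since 0 is a coboundary, [f] lies in its own coset, which by triviality is the set of
   coboundaries. *)
have cob0 : coboundary br alpha 2 0.
  exists (on3 (fun _ _ _ => 0)).
    split=> [i v a x y|x|_ p x y|_ p x y z]; rewrite /on3.
    - by rewrite scaler0 addr0.
    - by rewrite linear0.
    - by [].
    - by rewrite !addr0.
  have bl := cochain3_trilinear br_cochain.
  apply/funext => x; rewrite delta2E /fund (trilinear0l bl) (trilinear0m bl).
  by rewrite !(trilinear0r bl) !subr0 addr0 oppr0.
have : cohomology br alpha 2 [set f + b | b in coboundary br alpha 2]%classic.
  by exists f.
rewrite H5 => fB; have : coboundary br alpha 2 f.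
  by rewrite -fB; exists 0; rewrite ?addr0.
move=> [g g_cochain <-]; exists (fun x y z => g [tuple x; y; z]).
  exact: cochain3P.
by rewrite on3K.
Qed.

End Delta.

(** * Integration *)

Section ObstructionCocycle.
Context {F : fieldType} {T : lmodType F}.
Variables (alpha : {linear T -> T}) (d : nat -> T -> T -> T -> T).
Hypothesis dc : forall l, cochain3 alpha (d l).
Let dl l := cochain3_trilinear (dc l).

Lemma obstruction_cochain n : cochain alpha 5 (on5 (obstruction alpha d n)).
Proof.
have al : linear alpha by move=> a x y; rewrite linearP.
have comp1 l h y z : linear h -> linear (fun x => d l (h x) y z).
  by move=> hl a u v; have [f1 _ _] := dl l; rewrite hl f1.
have comp2 l h x z : linear h -> linear (fun y => d l x (h y) z).
  by move=> hl a u v; have [_ f2 _] := dl l; rewrite hl f2.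
have comp3 l h x y : linear h -> linear (fun z => d l x y (h z)).
  by move=> hl a u v; have [_ _ f3] := dl l; rewrite hl f3.
apply: cochain_on5.
1-5: move=> ????; apply: linear_pred_sum => l; rewrite /fund;
  have [g1 g2 g3] := dl (n - l);
  (apply: linear_predD; [apply: linear_predD; [apply: linear_predD|]|]);
  do ?apply: linear_predN;
  first [exact: comp1 | exact: comp2 | exact: comp3].
- by move=> u v x z; rewrite /obstruction big1 // => l _; rewrite fund_alt.
- move=> u v x y z; rewrite /obstruction -!big_split big1 // => l _ /=.
  exact: fund_cyclic.
- move=> u v x y z; rewrite /obstruction linear_sum; apply: eq_bigr => l _.
  exact: fund_alpha.
Qed.

Lemma obstruction_cocycle n :
    (forall k u v x y z, (k < n)%N -> obstruction alpha d k u v x y z = 0) ->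
  cocycle (d 0%N) alpha 2 (on5 (obstruction alpha d n)).
Proof.
move=> obs0; split; first exact: obstruction_cochain.
apply/funext => x; rewrite (delta3E (dc 0%N)).
exact: (obstruction_bianchi dl (fun l => cochain3_alpha (dc l)) obs0).
Qed.

End ObstructionCocycle.

(** Dependent choice with the whole prefix as state, because a new coefficient depends on all
    earlier ones. *)
Lemma seq_choice (A : Type) (P : seq A -> Prop) :
    P [::] -> (forall s, P s -> exists a, P (rcons s a)) ->
  exists f : nat -> A, forall n, P (mkseq f n).
Proof.
move=> P0 PS; have [a0 _] := PS _ P0.
have [next nextP] : {next & forall s, P s -> P (rcons s (next s))}.
  (* [next] must be total, so on lists violating [P] it returns the dummy [a0]. *)
  apply: (choice (P := fun s a => P s -> P (rcons s a))) => s.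
  case: (pselect (P s)) => [/PS[a Pa]|nPs]; first by exists a.
  by exists a0.
pose build n := iter n (fun s => rcons s (next s)) [::].
exists (next \o build) => n.
have -> : mkseq (next \o build) n = build n.
  by elim: n => // n IH; rewrite mkseqS IH.
by elim: n => //= n; exact: nextP.
Qed.

(** * Adding one coefficient to a deformation *)

Section Extension.
Context {F : fieldType} {T : lmodType F}.
Variable alpha : {linear T -> T}.
Implicit Types d : nat -> T -> T -> T -> T.

Lemma eq_obstruction d d' n : (forall l, (l <= n)%N -> d l = d' l) ->
  obstruction alpha d n = obstruction alpha d' n.
Proof.
move=> dd'; do 5!apply/funext => ?; apply: eq_bigr => l _.
by rewrite !dd' ?leq_subr // -ltnS.
Qed.

(** The coefficient of index [n] enters only the end summands [l = 0] and [l = n], which are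
    distinct as [n] is positive. For [d] both of these vanish. *)
Lemma obstruction_extend d d' n u v x y z :
    (forall l, trilinear (d l)) -> (0 < n)%N ->
    (forall l, (l < n)%N -> d' l = d l) -> d n = (fun _ _ _ => 0) ->
  obstruction alpha d' n u v x y z = obstruction alpha d n u v x y z
    + (fund alpha (d 0%N) (d' n) u v x y z + fund alpha (d' n) (d 0%N) u v x y z).
Proof.
case: n => // n dl _ dd' dn; rewrite /obstruction.
rewrite big_ord_recr big_ord_recl [in RHS]big_ord_recr [in RHS]big_ord_recl /=.
rewrite !subn0 !subnn dd' // dn.
have d0 : fund alpha (d 0%N) (fun _ _ _ => 0) u v x y z = 0.
  rewrite /fund (trilinear0l (dl 0%N)) (trilinear0m (dl 0%N)).
  by rewrite !(trilinear0r (dl 0%N)) !subr0.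
have d0' : fund alpha (fun _ _ _ => 0) (d 0%N) u v x y z = 0.
  by rewrite /fund !subr0.
rewrite d0 d0' add0r addr0 [X in X + _ = _]addrC -addrA; congr (_ + _).
by apply: eq_bigr => i _; rewrite !dd' //= /bump leq0n; have := ltn_ord i; lia.
Qed.

End Extension.

Local Close Scope ring_scope.

Theorem theorem4p5 (F : fieldType) (T : lmodType F) (br : T -> T -> T -> T)
    (alpha : {linear T -> T})
    (homLTS : multiplicative_homLTS br alpha)
    (H5_trivial : cohomology_trivial br alpha 2)
    (d1 : 3.-tuple T -> T)
    (d1_cocycle : cocycle br alpha 1 d1) :
  exists d : nat -> T -> T -> T -> T,
    formal_deformation br alpha d /\
    forall x y z : T, d 1 x y z = d1 [tuple x; y; z].
Proof.
have [brl bralt brcyc brfund bralpha] := homLTS.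
have br_cochain : cochain3 alpha br by [].
pose e1 x y z := d1 [tuple x; y; z].
have [/cochain3P e1_cochain delta_d1] := d1_cocycle.
pose zero (_ _ _ : T) : T := 0%R.
(* The list [s] holds the coefficients from index 2 on; [D s] continues them by zero. *)
pose D s := nth zero (br :: e1 :: s).
pose P s := (forall l, cochain3 alpha (D s l)) /\
  forall n u v x y z, (n < (size s).+2)%N ->
    obstruction alpha (D s) n u v x y z = 0%R.
have zero_cochain : cochain3 alpha zero.
  split=> [|//|x y z|x y z]; rewrite /zero ?addr0 ?linear0 //.
  by split=> *; move=> a b c; rewrite scaler0 addr0.
have [||f Pf] := @seq_choice _ P.
- split=> [[|[|l]]|[|[|//]] u v x y z _].
  + exact: br_cochain.
  + exact: e1_cochain.
  + by rewrite /D /= nth_nil.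
  + by rewrite /obstruction big_ord1 /fund /D /= brfund; abelian_group.
  (* In order 1 the obstruction is, up to sign, the coboundary of [d1]. *)
  + have := congr1 (fun g => g [tuple u; v; x; y; z]) delta_d1.
    rewrite -(on3K d1) (delta2E br_cochain) => /eqP; rewrite oppr_eq0 => /eqP.
    by rewrite /obstruction 2!big_ord_recl big_ord0 /= addr0.
- move=> s [Dc obs0]; pose n := (size s).+2.
  (* The new coefficient [g] has as coboundary the obstruction of order [n] of the sequence
     continued by zero. *)
  have [g g_cochain delta_g] := cohomology_trivial_coboundary br_cochain H5_trivial
    (obstruction_cocycle Dc (n := n) (fun k u v x y z => @obs0 k u v x y z)).
  have DE l : D (rcons s g) l =
      if (l < n)%N then D s l else if l == n then g else zero.
    by rewrite /D -!rcons_cons nth_rcons.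
  exists g; split=> [l|k u v x y z].
    by rewrite DE; case: ifP => // _; case: ifP.
  rewrite size_rcons ltnS leq_eqVlt => /predU1P[->|lt_k]; last first.
    rewrite (@eq_obstruction _ _ _ _ (D s)) ?obs0 // => l le_l.
    by rewrite DE (leq_ltn_trans le_l lt_k).
  rewrite (@obstruction_extend _ _ _ (D s)) //; last 1 first.
  + by rewrite /D nth_default.
  (* The minus sign in [delta2E] makes the contribution of [g] cancel the old obstruction. *)
  + have := congr1 (fun h => h [tuple u; v; x; y; z]) delta_g.
    rewrite (delta2E br_cochain) /on5 /= DE ltnn eqxx => <-.
    by rewrite addNr.
  + by move=> l; exact: (cochain3_trilinear (Dc l)).
  + by move=> l lt_l; rewrite DE lt_l.
(* Index [l] of [D] reads entry [l - 2] of the list, so a prefix of length [l] already determines it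
   and longer prefixes agree. *)
pose d l := D (mkseq f l) l.
have dE n l : (l <= n)%N -> d l = D (mkseq f n) l.
  case: l => [|[|l]] // le_l; rewrite /d /D /= !nth_mkseq //; exact: ltnW.
have dc l : cochain3 alpha (d l) by exact: (Pf l).1.
exists d; split=> //; apply: obstruction0_deformation => //.
- by move=> l; exact: (cochain3_trilinear (dc l)).
- by move=> l; exact: (cochain3_alpha (dc l)).
- by move=> l; exact: (cochain3_alt (dc l)).
- by move=> l; exact: (cochain3_cyclic (dc l)).
move=> n u v x y z; rewrite (@eq_obstruction _ _ _ _ (D (mkseq f n))) => [|l].
  by apply: (Pf n).2; rewrite size_mkseq.
exact: dE.
Qed.
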